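(* Let $A\in\mathbb{R}^{m\times n}$, $b\in\mathbb{R}^m$ with $Ax=b$ consistent, let $B\in\mathbb{R}^{n\times n}$ be symmetric positive definite, and let $S$ be a random matrix with $m$ rows. Starting from $x^0\in\mathbb{R}^n$, let $\{x^k\}$ be the random iterates $$x^{k+1}=x^k-B^{-1}A^\top S(S^\top AB^{-1}A^\top S)^\dagger S^\top(Ax^k-b),$$ where in each iteration $S$ is a fresh independent copy of the random matrix. Then for every $x^*\in\mathbb{R}^n$ satisfying $Ax^*=b$ and all $k\ge 0$, $$\mathbf{E}[x^{k+1}-x^*]=\left(I-B^{-1}\mathbf{E}[Z]\right)\mathbf{E}[x^k-x^*].$$ Moreover, $$\|I-B^{-1}\mathbf{E}[Z]\|_B=1-\lambda_{\min}(B^{-1/2}\mathbf{E}[Z]B^{-1/2})=\rho .$$ Therefore, $$\|\mathbf{E}[x^k-x^*]\|_B\le\rho^k\|x^0-x^*\|_B .$$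
   Context: $Z=A^\top S(S^\top AB^{-1}A^\top S)^\dagger S^\top A$, where $\dagger$ denotes the Moore–Penrose pseudoinverse, and $\rho=1-\lambda_{\min}(B^{-1/2}\mathbf{E}[Z]B^{-1/2})$, where $\lambda_{\min}$ is the smallest eigenvalue. For vectors, $\|x\|_B=\sqrt{x^\top Bx}$; for $M\in\mathbb{R}^{n\times n}$, $\|M\|_B=\max_{\|x\|_B=1}\|Mx\|_B$. $B^{-1/2}$ is the symmetric positive definite square root of $B^{-1}$. The number of columns of the random matrix $S$ is arbitrary (it may itself be random). The starting point $x^0$ is deterministic. *)

(* Defs.v *)
From HB Require Import structures.
From mathcomp Require Import all_boot all_order all_algebra.
From mathcomp Require Import all_classical all_reals all_analysis.
Set Implicit Arguments.
Unset Strict Implicit.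
Unset Printing Implicit Defensive.
Import Order.TTheory GRing.Theory Num.Theory.
Import numFieldNormedType.Exports.
Local Open Scope classical_set_scope.
Local Open Scope ring_scope.

Section LinearAlgebra.
Context {R : realType}.

Definition spd {n} (B : 'M[R]_n) : Prop :=
  B^T = B /\ forall x : 'cV[R]_n, x != 0 -> 0 < (x^T *m B *m x) 0 0.

(* The four Penrose equations; they have exactly one solution [X]. *)
Definition penrose {p q} (M : 'M[R]_(p, q)) (X : 'M[R]_(q, p)) : Prop :=
  [/\ M *m X *m M = M,
      X *m M *m X = X,
      (M *m X)^T = M *m X &
      (X *m M)^T = X *m M].

Definition pinvmp {p q} (M : 'M[R]_(p, q)) : 'M[R]_(q, p) :=
  xget 0 [set X | penrose M X].

(* The symmetric positive definite square root, unique when [spd M]; the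
   default 0 is only reached when there is none. *)
Definition sqrtmx {n} (M : 'M[R]_n) : 'M[R]_n :=
  xget 0 [set C | spd C /\ C *m C = M].

(* Greatest and least element of a set of reals that has one. *)
Definition set_max (E : set R) : R := xget 0 (E `&` ubound E).
Definition set_min (E : set R) : R := xget 0 (E `&` lbound E).

Definition lambda_min {n} (M : 'M[R]_n) : R := set_min [set a | eigenvalue M a].

Definition vnorm {n} (B : 'M[R]_n) (x : 'cV[R]_n) : R :=
  Num.sqrt ((x^T *m B *m x) 0 0).

Definition opnorm {n} (B M : 'M[R]_n) : R :=
  set_max [set vnorm B (M *m x) | x in [set x | vnorm B x = 1]].

End LinearAlgebra.

(* Matrices with [m] rows and any number of columns: [tag s] is the number of
   columns and [tagged s : 'M_(m, tag s)] the matrix. *)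
Definition sketch (R : realType) (m : nat) : Type := {q : nat & 'M[R]_(m, q)}.

HB.instance Definition _ (R : realType) (m : nat) :=
  Choice.copy (sketch R m) {q : nat & 'M[R]_(m, q)}.
HB.instance Definition _ (R : realType) (m : nat) :=
  isPointed.Build (sketch R m) (existT (fun q => 'M[R]_(m, q)) 0%N 0).

Fact sketch_display : measure_display.
Proof. exact: default_measure_display. Qed.

Section SketchMeasurable.
Context (R : realType) (m : nat).

(* Disjoint union over [q] of the Borel sigma-algebras of 'M_(m, q). *)
Definition sketch_measurable (E : set (sketch R m)) : Prop :=
  forall q : nat, <<s @open 'M[R]_(m, q) >> [set M | E (existT _ q M)].

Let sketch_measurable0 : sketch_measurable set0.
Proof. by move=> q; exact: sigma_algebra0. Qed.

Let sketch_measurableC E :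
  sketch_measurable E -> sketch_measurable (~` E).
Proof.
move=> mE q; have := sigma_algebraCD (mE q).
by rewrite setTD.
Qed.

Let sketch_measurable_bigcup (F : (set (sketch R m))^nat) :
  (forall i, sketch_measurable (F i)) -> sketch_measurable (\bigcup_i F i).
Proof. by move=> mF q; exact: sigma_algebra_bigcup (fun i => mF i q). Qed.

HB.instance Definition _ := isMeasurable.Build sketch_display (sketch R m)
  sketch_measurable0 sketch_measurableC sketch_measurable_bigcup.

End SketchMeasurable.

Section Probability.
Local Open Scope ereal_scope.
Context {d : measure_display} {T : measurableType d} {R : realType}.

Definition mutually_independent {d'} {U : measurableType d'}
    (P : probability T R) (X : nat -> {RV P >-> U}) : Prop :=
  forall (J : seq nat) (E : nat -> set U),
    uniq J -> (forall j, measurable (E j)) ->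
    P (\bigcap_(j in [set` J]) (X j @^-1` E j)) =
    \prod_(j <- J) P (X j @^-1` E j).

Definition same_distribution {d'} {U : measurableType d'}
    (P : probability T R) (X Y : {RV P >-> U}) : Prop :=
  forall E : set U, measurable E -> distribution P X E = distribution P Y E.

(* Entrywise expectation. [fine] would send an infinite entry to 0, but the
   random matrices Z and x^k - x^* below are measurable and bounded, hence
   integrable. *)
Definition mexpectation {p q} (P : probability T R) (X : T -> 'M[R]_(p, q)) :
    'M[R]_(p, q) :=
  \matrix_(i, j) fine 'E_P[fun w => X w i j].

End Probability.

Section Sketching.
Local Open Scope ring_scope.
Context {R : realType} {m n : nat}.

Definition Zmx (A : 'M[R]_(m, n)) (B : 'M[R]_n) (s : sketch R m) : 'M[R]_n :=
  let S := tagged s in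
  A^T *m S *m pinvmp (S^T *m A *m invmx B *m A^T *m S) *m S^T *m A.

Definition sketch_step (A : 'M[R]_(m, n)) (b : 'cV[R]_m) (B : 'M[R]_n)
    (s : sketch R m) (x : 'cV[R]_n) : 'cV[R]_n :=
  let S := tagged s in
  x - invmx B *m A^T *m S *m pinvmp (S^T *m A *m invmx B *m A^T *m S)
        *m S^T *m (A *m x - b).

Definition rho {d : measure_display} {T : measurableType d}
    (P : probability T R) (A : 'M[R]_(m, n)) (B : 'M[R]_n)
    (S : T -> sketch R m) : R :=
  1 - lambda_min (sqrtmx (invmx B) *m mexpectation P (Zmx A B \o S)
                    *m sqrtmx (invmx B)).

End Sketching.

(* Main.v *)
Require Import Defs.
From mathcomp Require Import all_boot all_order all_algebra.
From mathcomp Require Import all_classical all_reals all_analysis.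
From mathcomp Require Import complex measurable_realfun ring lra.
Set Implicit Arguments.
Unset Strict Implicit.
Unset Printing Implicit Defensive.
Import Order.TTheory GRing.Theory Num.Theory.
Import numFieldNormedType.Exports.
Local Open Scope classical_set_scope.
Local Open Scope ring_scope.

(* With C = B^(-1/2) and W = C A^T S, the matrix C Z C is the orthogonal
   projection onto the range of W. Hence C E[Z] C is symmetric with spectrum in
   [0, 1], and I - B^-1 E[Z] = C (I - C E[Z] C) C^-1 while |C y|_B = |y|, so its
   B-norm is the largest eigenvalue 1 - lambda_min of I - C E[Z] C.
   The error satisfies x^(k+1) - xs = (I - B^-1 Z_k) (x^k - xs); its entries are
   polynomials in the bounded entries of Z_0, ..., Z_(k-1), and independence makes
   them uncorrelated with Z_k. The entries of Z are measurable because the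
   projection onto the range of W is the limit of G (G + e I)^-1 for G = W W^T. *)

(** * Real symmetric and positive definite matrices *)

(** No moment of [S] is assumed to exist. What makes every expectation harmless is that [Z] is
    conjugate, by the fixed matrix [C^-1], to an orthogonal projection, whose entries lie in [-1, 1]
    whatever [S] is; all integrals are thus integrals of bounded functions.

    Two obstacles shape the probabilistic half. The pseudoinverse is not continuous, and its size
    changes with the number of columns of [S]; the regularized form depends on [S] only through
    [S S^T], which has a fixed size and a continuous dependence on [S]. Secondly, independence and
    equality in law are given on events, whereas products and means of functions are wanted. Both
    passages go through one induction principle for linear functionals that vanish on indicators,
    and conditional expectation is replaced by a product formula carried along the iteration.

    On the algebraic side, bounds on spectra are kept as bounds on quadratic forms, since these are
    linear in the matrix and survive taking expectations. *)

Lemma sqnormE (R : pzRingType) n (x : 'cV[R]_n) :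
  (x^T *m x) 0 0 = \sum_i x i 0 ^+ 2.
Proof. by rewrite mxE; apply: eq_bigr => i _; rewrite mxE expr2. Qed.

Lemma sqnorm_ge0 (R : realDomainType) n (x : 'cV[R]_n) : 0 <= (x^T *m x) 0 0.
Proof. by rewrite sqnormE sumr_ge0 // => i _; rewrite sqr_ge0. Qed.

Lemma sqnorm_eq0 (R : realDomainType) n (x : 'cV[R]_n) :
  ((x^T *m x) 0 0 == 0) = (x == 0).
Proof.
rewrite sqnormE psumr_eq0; last by move=> i _; rewrite sqr_ge0.
apply/allP/eqP => [x0|-> i _]; last by rewrite mxE expr0n /= eqxx.
apply/colP => i; rewrite mxE; apply/eqP.
have := x0 i (mem_index_enum i); by rewrite sqrf_eq0.
Qed.

Lemma row_sqnorm_eq0 (R : realDomainType) n (v : 'rV[R]_n) :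
  ((v *m v^T) 0 0 == 0) = (v == 0).
Proof. by rewrite -[v in v *m _]trmxK sqnorm_eq0 -trmx0 (inj_eq trmx_inj). Qed.

(** The diagonal entries of [M^T M] are the squared norms of the columns of [M]. *)
Lemma trmx_mul_eq0 (R : realDomainType) m n (M : 'M[R]_(m, n)) :
  M^T *m M = 0 -> M = 0.
Proof.
move=> M0; apply/matrixP => i j; rewrite mxE.
suff /eqP/colP/(_ i) : col j M == 0 by rewrite !mxE.
have /matrixP/(_ j j) := M0; rewrite -sqnorm_eq0 !mxE => M0j.
by apply/eqP; apply: etrans M0j; apply: eq_bigr => k _; rewrite !mxE.
Qed.

(** Over the complex numbers the matrix is Hermitian, so it is unitarily diagonalizable with real
    spectrum. A real eigenvalue of the complexified matrix is already one over [R]; real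
    eigenvectors are recovered later by deflation. *)
Lemma symmetric_eigenvalue (R : rcfType) n (A : 'M[R]_n) :
  (0 < n)%N -> A^T = A -> exists a, eigenvalue A a.
Proof.
case: n A => // n A _ A_sym; set Ac := map_mx (real_complex R) A.
have Ac_herm : Ac \is hermsymmx.
  apply: realsym_hermsym.
    by apply/is_hermitianmxP; rewrite expr0 scale1r map_mx_id // map_trmx A_sym.
  by apply/mxOverP => i j; rewrite mxE; apply/complex_realP; exists (A i j).
have /orthomx_spectralP Ac_eq := hermitian_normalmx Ac_herm.
have /mxOverP/(_ 0 0)/complex_realP[a a_eq] := hermitian_spectral_diag_real Ac_herm.
exists a; rewrite -(eigenvalue_map (real_complex R)).
have P_unit := spectral_unit Ac.
apply/eigenvalueP; exists (row 0 (spectralmx Ac)); last first.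
  by apply: contraTneq P_unit => P0; rewrite -row_free_unit; apply/negP => /row_freeP[X];
     move=> /(congr1 (row 0)); rewrite row_mul P0 mul0mx => /rowP/(_ 0);
     rewrite !mxE eqxx => /eqP; rewrite eq_sym oner_eq0.
have PA : spectralmx Ac *m Ac = diag_mx (spectral_diag Ac) *m spectralmx Ac.
  by rewrite {2}Ac_eq !mulmxA mulmxV // mul1mx.
by rewrite -row_mul PA row_mul row_diag_mx a_eq -scalemxAl -rowE.
Qed.

(** The Householder reflection along [u = e - v]. As both vectors are unit, [e u^T] is half of
    [|u|^2], so removing twice the component along [u] sends [e] to [v]. When [e = v] there is no
    direction to reflect along and the identity serves. *)
Lemma reflection_orthogonal (R : realFieldType) n (e v : 'rV[R]_n) :
  (e *m e^T) 0 0 = 1 -> (v *m v^T) 0 0 = 1 ->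
  exists2 P : 'M[R]_n, P *m P^T = 1%:M & e *m P = v.
Proof.
move=> e1 v1; have [<-|ev] := eqVneq e v.
  by exists 1%:M; rewrite ?trmx1 mulmx1.
pose u := e - v; pose c := (u *m u^T) 0 0.
have uuT : u *m u^T = c%:M by rewrite [LHS]mx11_scalar.
have c_neq0 : c != 0.
  by rewrite /c row_sqnorm_eq0 subr_eq0.
have euT : e *m u^T = (c / 2)%:M.
  rewrite [LHS]mx11_scalar; congr _%:M.
  have ve : (v *m e^T) 0 0 = (e *m v^T) 0 0.
    by rewrite -[LHS]trace_mx11 -mxtrace_tr trmx_mul trmxK trace_mx11.
  have subE (p q : 'M[R]_1) : (p - q) 0 0 = p 0 0 - q 0 0 by rewrite !mxE.
  rewrite /c /u linearB /= !mulmxBr !mulmxBl !subE e1 v1 ve.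
  by field.
pose k := 2 / c.
pose P : 'M[R]_n := 1%:M - k *: (u^T *m u).
have P_sym : P^T = P.
  by rewrite [LHS]linearB /= trmx1 [X in _ - X]linearZ /= trmx_mul trmxK.
exists P; rewrite ?P_sym /P.
  have : (u^T *m u) *m (u^T *m u) = c *: (u^T *m u).
    by rewrite mulmxA -[u^T *m u *m u^T]mulmxA uuT mul_mx_scalar scalemxAl.
  move: (u^T *m u) => X XX.
  rewrite mulmxBl !mulmxBr !mul1mx mulmx1 -scalemxAl -scalemxAr scalerA XX scalerA.
  have -> : k * k * c = k + k by rewrite /k; field.
  by rewrite scalerDl opprB addrK subrK.
rewrite mulmxBr mulmx1 -scalemxAr mulmxA euT mul_scalar_mx scalerA.
have -> : k * (c / 2) = 1 by rewrite /k; field.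
by rewrite scale1r /u opprB addrC subrK.
Qed.

(** Deflation: an orthogonal change of basis moves a unit eigenvector to the first basis vector,
    symmetry then splits off a 1 by 1 block, and the induction hypothesis diagonalizes the remaining
    block. *)
Lemma symmetric_spectral (R : rcfType) n (A : 'M[R]_n) : A^T = A ->
  exists (Q : 'M[R]_n) (d : 'rV[R]_n),
    Q *m Q^T = 1%:M /\ A = Q^T *m diag_mx d *m Q.
Proof.
elim: n A => [|n IHn] A A_sym.
  by exists 1%:M, 0; split; apply/matrixP => -[].
rewrite -[n.+1]/(1 + n)%N in A A_sym *.
have [a /eigenvalueP[w wA w_neq0]] := symmetric_eigenvalue (ltn0Sn n) A_sym.
have w_gt0 : 0 < (w *m w^T) 0 0.
  by rewrite lt_def row_sqnorm_eq0 w_neq0 -{1}[w]trmxK sqnorm_ge0.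
pose s := (Num.sqrt ((w *m w^T) 0 0))^-1; pose v := s *: w.
have v1 : (v *m v^T) 0 0 = 1.
  rewrite /v linearZ /= -scalemxAl -scalemxAr scalerA mxE /s -invfM -expr2.
  by rewrite sqr_sqrtr ?ltW // mulVf // gt_eqF.
have vA : v *m A = a *: v by rewrite -scalemxAl wA !scalerA mulrC.
pose e : 'rV[R]_(1 + n) := delta_mx 0 0.
have e1 : (e *m e^T) 0 0 = 1 by rewrite trmx_delta mul_delta_mx mxE !eqxx.
have [P PP eP] := reflection_orthogonal e1 v1.
pose M : 'M[R]_(1 + n) := P *m A *m P^T.
have M_sym : M^T = M by rewrite /M !trmx_mul trmxK A_sym mulmxA.
have rowM : row 0 M = a *: e.
  by rewrite rowE /M !mulmxA eP vA -scalemxAl -eP -mulmxA PP mulmx1.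
have PP' : P^T *m P = 1%:M by apply: mulmx1C.
have A_eq : A = P^T *m M *m P by rewrite /M !mulmxA PP' mul1mx -mulmxA PP' mulmx1.
clearbody M.
(* The first row of [M] gives the two upper blocks; the lower left one is zero by symmetry. *)
have M_eq : M = block_mx a%:M 0 0 (drsubmx M).
  rewrite -[LHS]submxK; congr block_mx.
  - rewrite [LHS]mx11_scalar; congr _%:M; move/rowP/(_ 0): rowM.
    by rewrite !mxE !eqxx mulr1 => <-; congr (M _ _); apply/val_inj.
  - apply/matrixP => i j; move/rowP/(_ (rshift 1 j)): rowM; rewrite !mxE.
    by rewrite mulr0 ord1 => <-; congr (M _ _); apply/val_inj.
  - rewrite -[LHS]trmxK -[X in _ = X]trmxK; congr (_ ^T).
    rewrite trmx_dlsub M_sym trmx0.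
    apply/matrixP => i j; move/rowP/(_ (rshift 1 j)): rowM; rewrite !mxE.
    by rewrite mulr0 ord1 => <-; congr (M _ _); apply/val_inj.
have [Q' [d' [QQ' A'_eq]]] := IHn (drsubmx M) ltac:(by rewrite trmx_drsub M_sym).
pose Q1 : 'M[R]_(1 + n) := block_mx 1%:M 0 0 Q'.
have QQ1 : Q1 *m Q1^T = 1%:M.
  rewrite /Q1 tr_block_mx mulmx_block !trmx1 !trmx0 !mulmx0 !mul0mx !mulmx1 QQ'.
  by rewrite !addr0 add0r -scalar_mx_block.
exists (Q1 *m P), (row_mx a%:M d'); split.
  by rewrite trmx_mul mulmxA -[Q1 *m P *m P^T]mulmxA PP mulmx1.
rewrite [LHS]A_eq.
rewrite trmx_mul -!mulmxA; congr (_ *m _); rewrite !mulmxA; congr (_ *m _).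
have -> : diag_mx (row_mx a%:M d') = block_mx a%:M 0 0 (diag_mx d').
  rewrite diag_mx_row; congr block_mx.
  by apply/matrixP => i j; rewrite !ord1 !mxE eqxx.
rewrite /Q1 tr_block_mx !mulmx_block !trmx1 !trmx0.
rewrite !mulmx0 !mul0mx !mulmx1 !mul1mx !addr0 !add0r.
by rewrite !mul0mx -A'_eq {1}M_eq.
Qed.

Section Spd.
Variable R : realType.

Lemma spd_unitmx n (B : 'M[R]_n) : spd B -> B \in unitmx.
Proof.
move=> [B_sym B_pos]; rewrite -row_free_unit; apply: inj_row_free => v vB.
apply/eqP; apply: contraT => v_neq0.
have /B_pos : v^T != 0 by rewrite -trmx0 (inj_eq trmx_inj).
by rewrite trmxK vB mul0mx mxE ltxx.
Qed.

Lemma spd_invmx n (B : 'M[R]_n) : spd B -> spd (invmx B).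
Proof.
move=> B_spd; have [B_sym B_pos] := B_spd; have B_unit := spd_unitmx B_spd.
have inv_sym : (invmx B)^T = invmx B by rewrite trmx_inv B_sym.
split=> // x x_neq0.
have -> : x^T *m invmx B *m x = (invmx B *m x)^T *m B *m (invmx B *m x).
  by rewrite trmx_mul inv_sym !mulmxA mulmxKV.
apply: B_pos; apply: contra_neq x_neq0 => /(congr1 (mulmx B)).
by rewrite mulmx0 mulKVmx.
Qed.

Lemma spd_sqrt_exists n (M : 'M[R]_n) :
  spd M -> exists C : 'M[R]_n, spd C /\ C *m C = M.
Proof.
move=> [M_sym M_pos]; have [Q [d [QQ M_eq]]] := symmetric_spectral M_sym.
have QQ' := mulmx1C QQ.
(* [d 0 i] is the value of the quadratic form of [M] at the eigenvector [Q^T e_i]. *)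
have d_gt0 i : 0 < d 0 i.
  have q_neq0 : Q^T *m delta_mx i 0 != 0 :> 'cV_n.
    apply/eqP => /(congr1 (mulmx Q)); rewrite mulmxA QQ mul1mx mulmx0.
    by move=> /colP/(_ i)/eqP; rewrite !mxE !eqxx oner_eq0.
  have := M_pos _ q_neq0; rewrite M_eq trmx_mul trmxK !mulmxA.
  rewrite -[_ *m Q *m Q^T]mulmxA QQ mulmx1 -[_ *m Q *m Q^T]mulmxA QQ mulmx1.
  rewrite trmx_delta -rowE -colE !mxE eqxx mulr1n //.
pose s := map_mx Num.sqrt d.
have ss : diag_mx s *m diag_mx s = diag_mx d.
  rewrite mulmx_diag; congr diag_mx; apply/rowP => i.
  by rewrite !mxE -expr2 sqr_sqrtr // ltW.
exists (Q^T *m diag_mx s *m Q); split; last first.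
  by rewrite !mulmxA -[_ *m Q *m Q^T]mulmxA QQ mulmx1 -[_ *m _ *m diag_mx s]mulmxA ss.
split=> [|x x_neq0]; first by rewrite !trmx_mul trmxK tr_diag_mx mulmxA.
set y := Q *m x.
have -> : x^T *m (Q^T *m diag_mx s *m Q) *m x = y^T *m (diag_mx s *m y).
  by rewrite /y trmx_mul !mulmxA.
have y_neq0 : y != 0.
  apply: contra_neq x_neq0 => /(congr1 (mulmx Q^T)).
  by rewrite mulmxA QQ' mul1mx mulmx0.
have yE : (y^T *m (diag_mx s *m y)) 0 0 = \sum_i s 0 i * y i 0 ^+ 2.
  by rewrite mxE; apply: eq_bigr => i _; rewrite mul_diag_mx !mxE expr2 mulrCA.
have t_ge0 i : 0 <= s 0 i * y i 0 ^+ 2.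
  by rewrite mulr_ge0 ?sqr_ge0 // mxE sqrtr_ge0.
rewrite yE lt_def sumr_ge0 // andbT; apply: contra_neq y_neq0 => sum0.
apply/colP => i; rewrite [RHS]mxE; apply/eqP.
move/eqP: sum0; rewrite psumr_eq0; last by move=> j _; exact: t_ge0.
move=> /allP/(_ i (mem_index_enum i)).
by rewrite /= mulf_eq0 sqrf_eq0 [s _ _]mxE sqrtr_eq0 leNgt d_gt0.
Qed.

Lemma sqrtmxP n (M : 'M[R]_n) :
  spd M -> spd (sqrtmx M) /\ sqrtmx M *m sqrtmx M = M.
Proof.
by move=> /spd_sqrt_exists M_sqrt; exact: (xgetPex (0 : 'M[R]_n) M_sqrt).
Qed.

(** * Pseudoinverse and orthogonal projection onto a range *)

Lemma gram_unitmx p r (F : 'M[R]_(p, r)) : row_full F -> F^T *m F \in unitmx.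
Proof.
move=> /row_fullP[L LF]; rewrite -row_free_unit; apply: inj_row_free => v vFF.
have Fv0 : F *m v^T = 0.
  by apply: trmx_mul_eq0; rewrite trmx_mul trmxK mulmxA -[_ *m _ *m F]mulmxA vFF mul0mx.
apply: trmx_inj; rewrite -[v^T]mul1mx -LF -mulmxA Fv0 mulmx0 trmx0 //.
Qed.

(** The classical formula for the pseudoinverse of a full-rank factorization:
    [G^T (G G^T)^-1 (F^T F)^-1 F^T]. Every matrix has such a factorization through a column base and
    a row base. *)
Lemma penrose_mulmx p r q (F : 'M[R]_(p, r)) (G : 'M[R]_(r, q)) :
  row_full F -> row_free G -> exists X, penrose (F *m G) X.
Proof.
move=> F_full G_free.
have F_unit : F^T *m F \in unitmx by rewrite gram_unitmx.
have G_unit : G *m G^T \in unitmx.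
  by rewrite -[G in G *m _]trmxK gram_unitmx // /row_full mxrank_tr; exact: G_free.
pose I := invmx (F^T *m F); pose J := invmx (G *m G^T).
pose X := G^T *m J *m I *m F^T.
have MX : F *m G *m X = F *m I *m F^T.
  by rewrite /X !mulmxA -[F *m G *m G^T]mulmxA mulmxK.
have XM : X *m (F *m G) = G^T *m J *m G.
  by rewrite /X !mulmxA -[_ *m F^T *m F]mulmxA mulmxKV.
exists X; split.
- by rewrite MX !mulmxA -[_ *m F^T *m F]mulmxA mulmxKV.
- by rewrite XM /X !mulmxA -[_ *m G *m G^T]mulmxA mulmxKV.
- by rewrite MX !trmx_mul trmxK trmx_inv trmx_mul trmxK mulmxA.
- by rewrite XM !trmx_mul trmxK trmx_inv trmx_mul trmxK mulmxA.
Qed.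

Lemma penrose_exists p q (M : 'M[R]_(p, q)) : exists X, penrose M X.
Proof.
rewrite -{1}(mulmx_base M).
exact: (penrose_mulmx (col_base_full M) (row_base_free M)).
Qed.

Lemma pinvmpP p q (M : 'M[R]_(p, q)) : penrose M (pinvmp M).
Proof. exact: (xgetPex (0 : 'M[R]_(q, p)) (penrose_exists M)). Qed.

(** The orthogonal projector onto the column space of [W], in a form that also covers rank-deficient
    [W]. It is identified by the next three lemmas: it fixes [W], is symmetric and is idempotent. *)
Definition range_proj n q (W : 'M[R]_(n, q)) := W *m pinvmp (W^T *m W) *m W^T.

(** The defect is [D = W (X M - 1)], and [W^T D = M X M - M = 0]. Since [D] factors through [W] on
    the left, [D^T D = 0]. *)
Lemma range_proj_id n q (W : 'M[R]_(n, q)) : range_proj W *m W = W.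
Proof.
set M := W^T *m W; set X := pinvmp M.
have [MXM _ _ _] : penrose M X := pinvmpP M.
apply/eqP; rewrite -subr_eq0; apply/eqP/trmx_mul_eq0.
have -> : range_proj W *m W - W = W *m (X *m M - 1%:M).
  by rewrite /range_proj mulmxBr mulmx1 !mulmxA.
have W0 : W^T *m (W *m (X *m M - 1%:M)) = 0.
  by rewrite mulmxA mulmxBr mulmx1 mulmxA MXM subrr.
by rewrite trmx_mul -mulmxA W0 mulmx0.
Qed.

(** The projector [Pi] equals [Pi Pi^T], which is visibly symmetric; this follows from
    [Pi W = W]. *)
Lemma range_proj_sym n q (W : 'M[R]_(n, q)) : (range_proj W)^T = range_proj W.
Proof.
have PiPiT : range_proj W *m (range_proj W)^T = range_proj W.
  by rewrite {1}/range_proj -mulmxA -[W^T *m _^T]trmx_mul range_proj_id.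
by rewrite -[in LHS]PiPiT trmx_mul trmxK.
Qed.

Lemma range_proj_idem n q (W : 'M[R]_(n, q)) :
  range_proj W *m range_proj W = range_proj W.
Proof. by rewrite {2}/range_proj !mulmxA range_proj_id. Qed.

End Spd.

(** * Orthogonal projections and symmetric contractions *)

Lemma sqr_coord_le_sqnorm (R : realDomainType) n (y : 'cV[R]_n) i :
  y i 0 ^+ 2 <= (y^T *m y) 0 0.
Proof.
by rewrite sqnormE (bigD1 i) //= lerDl sumr_ge0 // => k _; rewrite sqr_ge0.
Qed.

(** From [y_j^2 <= |y|^2 <= y_j] one gets [y_j <= 1], hence [|y| <= 1]. The hypothesis is what a
    column of a projection satisfies, and also a column of [e (G + e)^-1]. *)
Lemma sqnorm_le_coord (R : realFieldType) n (y : 'cV[R]_n) j :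
  (y^T *m y) 0 0 <= y j 0 -> forall i, `|y i 0| <= 1.
Proof.
move=> yj i; have yj_sqr := sqr_coord_le_sqnorm y j.
have yi_sqr := sqr_coord_le_sqnorm y i.
have yj1 : y j 0 <= 1 by rewrite expr2 in yj_sqr; nra.
have : y i 0 ^+ 2 <= 1 by exact: le_trans yi_sqr (le_trans yj yj1).
by rewrite ler_norml expr2 => yi; apply/andP; split; nra.
Qed.

Lemma coord_mxB (V : zmodType) m n (M N : 'M[V]_(m, n)) i j :
  (M - N) i j = M i j - N i j.
Proof. by rewrite !mxE. Qed.

Lemma coord_mxD (V : nmodType) m n (M N : 'M[V]_(m, n)) i j :
  (M + N) i j = M i j + N i j.
Proof. by rewrite !mxE. Qed.

Lemma coord_mxZ (V : pzRingType) m n a (M : 'M[V]_(m, n)) i j :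
  (a *: M) i j = a * M i j.
Proof. by rewrite !mxE. Qed.

Lemma coord_mul_diag_mx (V : pzSemiRingType) m n (d : 'rV[V]_m) (M : 'M[V]_(m, n)) i j :
  (diag_mx d *m M) i j = d 0 i * M i j.
Proof. by rewrite mul_diag_mx mxE. Qed.

Section Contraction.
Variable R : realType.

Section Projection.
Variables (n : nat) (P : 'M[R]_n).
Hypotheses (P_sym : P^T = P) (P_idem : P *m P = P).

Lemma proj_norm (x : 'cV_n) : x^T *m P *m x = (P *m x)^T *m (P *m x).
Proof. by rewrite trmx_mul P_sym !mulmxA -[_ *m _ *m P]mulmxA P_idem. Qed.

Lemma proj_ge0 (x : 'cV_n) : 0 <= (x^T *m P *m x) 0 0.
Proof. by rewrite proj_norm sqnorm_ge0. Qed.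

(** The difference of the two sides is [|x - P x|^2]. *)
Lemma proj_le (x : 'cV_n) : (x^T *m P *m x) 0 0 <= (x^T *m x) 0 0.
Proof.
have := sqnorm_ge0 (x - P *m x).
rewrite [(x - _)^T]linearB /= mulmxBl !mulmxBr -proj_norm trmx_mul P_sym.
by rewrite !mulmxA subrr subr0 coord_mxB subr_ge0.
Qed.

Lemma proj_entry_le1 i j : `|P i j| <= 1.
Proof.
have -> : P i j = col j P i 0 by rewrite mxE.
apply: (@sqnorm_le_coord _ _ _ j).
have <- : delta_mx 0 j *m P *m delta_mx j 0 = (col j P)^T *m col j P.
  by rewrite -[delta_mx 0 j]trmxK trmx_delta proj_norm -colE.
by rewrite -mulmxA -colE -rowE !mxE.
Qed.

End Projection.

Lemma resolvent_unitmx n q (W : 'M[R]_(n, q)) e :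
  0 < e -> W *m W^T + e%:M \in unitmx.
Proof.
move=> e_gt0; apply: spd_unitmx; split=> [|x x_neq0].
  by rewrite linearD /= trmx_mul trmxK tr_scalar_mx.
have -> : x^T *m (W *m W^T + e%:M) *m x = (W^T *m x)^T *m (W^T *m x) + e *: (x^T *m x).
  by rewrite mulmxDr mulmxDl trmx_mul trmxK !mulmxA mul_mx_scalar scalemxAl.
rewrite coord_mxD coord_mxZ ltr_wpDl ?sqnorm_ge0 // mulr_gt0 //.
by rewrite lt_def sqnorm_eq0 x_neq0 sqnorm_ge0.
Qed.

(* Tikhonov regularization: with G = W W^T the projection is the limit of
   G (G + e)^-1, which no longer involves a pseudoinverse. *)
Lemma range_proj_resolvent n q (W : 'M[R]_(n, q)) i j :
  exists c, forall e, 0 < e ->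
    `|range_proj W i j - (W *m W^T *m invmx (W *m W^T + e%:M)) i j| <= c * e.
Proof.
set Pi := range_proj W; set G := W *m W^T.
(* [K] is the pseudoinverse of [G], written through that of [W^T W]; it enters by the identity
   [Pi = K G]. *)
pose K := W *m pinvmp (W^T *m W) *m pinvmp (W^T *m W) *m W^T.
have PiE : Pi = K *m G.
  have [MXM _ MX XM] := pinvmpP (W^T *m W).
  set X := pinvmp (W^T *m W) in MXM MX XM K *.
  have XMWT : X *m (W^T *m W) *m W^T = W^T.
    have := congr1 trmx (range_proj_id W).
    rewrite -XM /range_proj !trmx_mul !trmxK -/X !mulmxA //.
  rewrite /Pi /range_proj -/X /K /G -{1}XMWT !mulmxA //.
have PiG : Pi *m G = G by rewrite /G mulmxA range_proj_id.
(* The error will be [e K (1 - e T)] with [T = (G + e)^-1]. The entries of [e T] are at most 1 in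
   absolute value, so those of [1 - e T] are at most 2. *)
exists (\sum_l `|K i l| * 2) => e e_gt0.
set T := invmx (G + e%:M).
have Ge_unit : G + e%:M \in unitmx by exact: resolvent_unitmx.
have GT : (G + e%:M) *m T = 1%:M by rewrite mulmxV.
have GT1 : G *m T = 1%:M - e *: T.
  by rewrite -GT mulmxDl mul_scalar_mx addrK.
have -> : Pi i j - (G *m T) i j = (e *: (K *m (1%:M - e *: T))) i j.
  have -> : e *: (K *m (1%:M - e *: T)) = Pi - G *m T.
    rewrite -GT1 mulmxA -PiE -[in RHS](mulmx1 Pi) -GT mulmxA mulmxDr PiG mulmxDl.
    by rewrite mul_mx_scalar addrC addKr scalemxAl.
  by rewrite coord_mxB.
(* The column [y] solves [(G + e) y = e e_j]. Pairing with [y] gives [|W^T y|^2 + e |y|^2 = e y_j],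
   hence [|y|^2 <= y_j]. *)
have eT l : `|(e *: T) l j| <= 1.
  pose y : 'cV_n := col j (e *: T).
  have -> : (e *: T) l j = y l 0 by rewrite [RHS]mxE.
  apply: (@sqnorm_le_coord _ _ _ j).
  have Gy : (G + e%:M) *m y = e *: delta_mx j 0.
    by rewrite /y colE -scalemxAl -scalemxAr mulmxA GT mul1mx.
  have : y^T *m (G + e%:M) *m y = e *: (y^T *m delta_mx j 0).
    by rewrite -mulmxA Gy scalemxAr.
  have -> : y^T *m (G + e%:M) *m y = (W^T *m y)^T *m (W^T *m y) + e *: (y^T *m y).
    by rewrite mulmxDr mulmxDl trmx_mul trmxK !mulmxA mul_mx_scalar scalemxAl.
  rewrite -colE => /matrixP/(_ 0 0).
  have := sqnorm_ge0 (W^T *m y).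
  rewrite coord_mxD !coord_mxZ.
  rewrite [(col j y^T) 0 0]mxE [y^T 0 j]mxE.
  move: (_ 0 0) ((y^T *m y) 0 0) (y j 0) => u v w u_ge0 uvw.
  by rewrite -(ler_pM2l e_gt0) -uvw lerDr.
rewrite mxE normrM gtr0_norm // mulrC ler_pM2r // mxE.
apply: le_trans (ler_norm_sum _ _ _) _; apply: ler_sum => l _.
rewrite normrM ler_wpM2l //; rewrite coord_mxB.
apply: le_trans (ler_normB _ _) _; have := eT l; rewrite [1%:M _ _]mxE.
by case: (_ == _); rewrite ?normr0 ?normr1; lra.
Qed.

(** Spectrum in [0, 1], expressed by quadratic forms so that the property is preserved by
    expectations. *)
Definition symmetric_contraction n (H : 'M[R]_n) :=
  H^T = H /\ forall x : 'cV_n, 0 <= (x^T *m H *m x) 0 0 <= (x^T *m x) 0 0.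

(** In an orthonormal eigenbasis [1 - H] multiplies coordinate [i] by [1 - d_i], and
    [0 <= 1 - d_i <= 1 - min d]. The dimension must be positive for an eigenvalue to exist;
    otherwise [lambda_min] is its default 0. *)
Lemma lambda_min_contraction n (H : 'M[R]_n) :
  (0 < n)%N -> symmetric_contraction H ->
  [/\ lambda_min H <= 1,
      exists2 y : 'cV_n, y != 0 & H *m y = lambda_min H *: y &
      forall y : 'cV_n, (((1%:M - H) *m y)^T *m ((1%:M - H) *m y)) 0 0 <=
        (1 - lambda_min H) ^+ 2 * (y^T *m y) 0 0].
Proof.
case: n H => // n H _ [H_sym H_contr].
have [Q [d [QQ H_eq]]] := symmetric_spectral H_sym.
have QQ' := mulmx1C QQ.
pose q i : 'cV_n.+1 := Q^T *m delta_mx i 0.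
have Hq i : H *m q i = d 0 i *: q i.
  rewrite H_eq /q -!mulmxA [Q *m _]mulmxA QQ mul1mx scalemxAr; congr (_ *m _).
  apply/matrixP => k l; rewrite mul_diag_mx !mxE.
  by case: eqVneq => [->//|_]; rewrite !mulr0.
have qq i : ((q i)^T *m q i) 0 0 = 1.
  rewrite /q trmx_mul trmxK trmx_delta mulmxA -[_ *m Q *m _]mulmxA QQ mulmx1.
  by rewrite mul_delta_mx mxE !eqxx.
have q_neq0 i : q i != 0 by rewrite -sqnorm_eq0 qq oner_eq0.
have d01 i : 0 <= d 0 i <= 1.
  have := H_contr (q i); rewrite -mulmxA Hq -scalemxAr.
  by rewrite coord_mxZ qq mulr1.
pose i0 := [arg min_(i < ord0) d 0 i]%O.
have d_min j : d 0 i0 <= d 0 j.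
  by rewrite /i0; case: arg_minP => // i _; exact.
have eig i : eigenvalue H (d 0 i).
  apply/eigenvalueP; exists (q i)^T; last by rewrite -trmx0 (inj_eq trmx_inj).
  by rewrite -[H]H_sym -trmx_mul Hq linearZ.
have lminE : lambda_min H = d 0 i0.
  (* Every eigenvalue is some [d 0 i]: in the eigenbasis an eigenvector has a nonzero coordinate
     [i], and comparing that coordinate gives [a = d 0 i]. *)
  have lb : lbound [set a | eigenvalue H a] (d 0 i0).
    move=> a /= /eigenvalueP[v vH v_neq0].
    have [i vi] : exists i, (v *m Q^T) 0 i != 0.
      apply/existsP; apply: contraNT v_neq0; rewrite negb_exists => /forallP v0.
      rewrite -[v]mulmx1 -QQ' mulmxA (_ : v *m Q^T = 0) ?mul0mx //.
      by apply/rowP => i; rewrite [RHS]mxE; apply/eqP; rewrite -[_ == _]negbK v0.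
    suff -> : a = d 0 i by [].
    apply: (mulIf vi); have := congr1 (mulmx^~ Q^T) vH.
    rewrite /= H_eq !mulmxA -[_ *m Q *m Q^T]mulmxA QQ mulmx1 -scalemxAl.
    by move/rowP/(_ i); rewrite mul_mx_diag mxE [RHS]mxE mulrC.
  apply: xget_unique; first by split=> //; exact: eig.
  by move=> a [/= a_eig a_lb]; apply/eqP; rewrite eq_le lb // a_lb //; exact: eig.
rewrite lminE; split.
- by case/andP: (d01 i0).
- by exists (q i0).
move=> y; set z := Q *m y.
have yE : y = Q^T *m z by rewrite /z mulmxA QQ' mul1mx.
have -> : (1%:M - H) *m y = Q^T *m (z - diag_mx d *m z).
  by rewrite mulmxBl mul1mx H_eq {1}yE mulmxBr /z !mulmxA.
have isoQ (u : 'cV_n.+1) : (Q^T *m u)^T *m (Q^T *m u) = u^T *m u.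
  by rewrite trmx_mul trmxK mulmxA -[_ *m Q *m _]mulmxA QQ mulmx1.
rewrite {1 2}yE !isoQ !sqnormE mulr_sumr; apply: ler_sum => i _.
have -> : (z - diag_mx d *m z) i 0 = (1 - d 0 i) * z i 0.
  by rewrite coord_mxB coord_mul_diag_mx mulrBl mul1r.
rewrite exprMn ler_wpM2r ?sqr_ge0 //.
have /andP[_ di1] := d01 i.
by rewrite lerXn2r ?nnegrE ?subr_ge0 ?lerB // (le_trans (d_min i)).
Qed.

End Contraction.

Lemma sqnormZ (R : comPzRingType) n a (y : 'cV[R]_n) :
  ((a *: y)^T *m (a *: y)) 0 0 = a ^+ 2 * (y^T *m y) 0 0.
Proof.
by rewrite !sqnormE mulr_sumr; apply: eq_bigr => i _; rewrite mxE exprMn.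
Qed.

(** * Operator norm induced by the B-norm *)

Section Opnorm.
Variables (R : realType) (n : nat) (B : 'M[R]_n).
Hypothesis B_spd : spd B.
Let C := sqrtmx (invmx B).

Lemma sqrt_inv_sym : C^T = C.
Proof. by have [[]] := sqrtmxP (spd_invmx B_spd). Qed.

Lemma sqrt_inv_sqr : C *m C = invmx B.
Proof. by have [] := sqrtmxP (spd_invmx B_spd). Qed.

Lemma sqrt_inv_unitmx : C \in unitmx.
Proof. by have [/spd_unitmx] := sqrtmxP (spd_invmx B_spd). Qed.

Lemma vnorm_sqrt_inv (y : 'cV_n) : vnorm B (C *m y) = Num.sqrt ((y^T *m y) 0 0).
Proof.
rewrite /vnorm trmx_mul sqrt_inv_sym; congr (Num.sqrt (_ 0 0)).
have CBC : C *m B *m C = 1%:M.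
  apply: mulmx1C; rewrite mulmxA sqrt_inv_sqr mulVmx //.
  exact: spd_unitmx B_spd.
by rewrite -!mulmxA [C *m (B *m _)]mulmxA [_ *m (C *m y)]mulmxA CBC mul1mx.
Qed.

Variable E : 'M[R]_n.
Hypothesis H_contr : symmetric_contraction (C *m E *m C).
Hypothesis n_gt0 : (0 < n)%N.
Let N := 1%:M - invmx B *m E.
Let a := lambda_min (C *m E *m C).

Let N_sqrt_inv (y : 'cV_n) : N *m (C *m y) = C *m ((1%:M - C *m E *m C) *m y).
Proof. by rewrite /N !mulmxBl !mul1mx mulmxBr -sqrt_inv_sqr !mulmxA. Qed.

Lemma vnorm_contraction (x : 'cV_n) : vnorm B (N *m x) <= (1 - a) * vnorm B x.
Proof.
have [a_le1 _ N_le] := lambda_min_contraction n_gt0 H_contr.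
have xE : x = C *m (invmx C *m x) by rewrite mulKVmx ?sqrt_inv_unitmx.
rewrite {}xE; move: (invmx C *m x) => y; rewrite N_sqrt_inv !vnorm_sqrt_inv.
rewrite -[1 - a]ger0_norm ?subr_ge0 // -sqrtr_sqr -sqrtrM ?sqr_ge0 //.
exact/ler_wsqrtr/N_le.
Qed.

Lemma opnorm_contraction : opnorm B N = 1 - a.
Proof.
have [a_le1 [y y_neq0 Hy] _] := lambda_min_contraction n_gt0 H_contr.
have N_ub : ubound [set vnorm B (N *m x) | x in [set x | vnorm B x = 1]] (1 - a).
  by move=> r [x /= x1 <-]; have := vnorm_contraction x; rewrite x1 mulr1.
have N_max : [set vnorm B (N *m x) | x in [set x | vnorm B x = 1]] (1 - a).
  set s := Num.sqrt ((y^T *m y) 0 0).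
  have s_gt0 : 0 < s by rewrite sqrtr_gt0 lt_def sqnorm_eq0 y_neq0 sqnorm_ge0.
  (* The maximum is attained at the image under [C] of the normalized eigenvector for the least
     eigenvalue of [C E C]. *)
  have vs : vnorm B (C *m (s^-1 *: y)) = 1.
    rewrite vnorm_sqrt_inv sqnormZ sqrtrM ?sqr_ge0 // sqrtr_sqr.
    by rewrite gtr0_norm ?invr_gt0 // mulVf ?gt_eqF.
  exists (C *m (s^-1 *: y)) => //; rewrite N_sqrt_inv.
  rewrite mulmxBl mul1mx -scalemxAr Hy -/a scalerA mulrC -scalerA.
  rewrite -[X in X - _]scale1r -scalerBl vnorm_sqrt_inv sqnormZ.
  rewrite sqrtrM ?sqr_ge0 // sqrtr_sqr ger0_norm ?subr_ge0 //.
  by rewrite -vnorm_sqrt_inv vs mulr1.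
apply: xget_unique; first by split.
by move=> r [r_in r_ub]; apply/eqP; rewrite eq_le N_ub // r_ub.
Qed.

End Opnorm.

Section Zmx.
Variables (R : realType) (m n : nat) (A : 'M[R]_(m, n)) (B : 'M[R]_n).
Hypothesis B_spd : spd B.
Let C := sqrtmx (invmx B).

(** Since [C C = B^-1], the matrix pseudo-inverted inside [Z] is the Gram matrix [W^T W] of
    [W = C A^T S]. *)
Lemma Zmx_range_proj s :
  C *m Zmx A B s *m C = range_proj (C *m A^T *m tagged s).
Proof.
rewrite /Zmx /range_proj !trmx_mul trmxK sqrt_inv_sym //; set S := tagged s.
have -> : S^T *m (A *m C) *m (C *m A^T *m S) = S^T *m A *m invmx B *m A^T *m S.
  by rewrite -sqrt_inv_sqr // !mulmxA.
by rewrite !mulmxA.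
Qed.

(** Makes the entries of [Z] fixed linear combinations of the entries of a projection; their
    boundedness and measurability come from this form. *)
Lemma Zmx_conj s : Zmx A B s =
  invmx C *m range_proj (C *m A^T *m tagged s) *m invmx C.
Proof.
rewrite -Zmx_range_proj !mulmxA mulVmx ?sqrt_inv_unitmx //.
by rewrite mul1mx mulmxK ?sqrt_inv_unitmx.
Qed.

Lemma sketch_step_error b (xs x : 'cV_n) s : A *m xs = b ->
  sketch_step A b B s x - xs = (1%:M - invmx B *m Zmx A B s) *m (x - xs).
Proof.
move=> <-; rewrite /sketch_step /Zmx -mulmxBr mulmxBl mul1mx addrAC.
by rewrite !mulmxA.
Qed.

End Zmx.

(** * Bounded measurable functions and independence *)

Section BoundedMeasurable.
Context {d : measure_display} {U : measurableType d} {R : realType}.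
Implicit Types f g : U -> R.

Definition bounded_measurable f :=
  measurable_fun setT f /\ exists M, forall u, `|f u| <= M.

Lemma bounded_measurable_cst c : bounded_measurable (fun=> c).
Proof. by split; [exact: measurable_cst | exists `|c|]. Qed.

Lemma bounded_measurableD f g :
  bounded_measurable f -> bounded_measurable g ->
  bounded_measurable (fun u => f u + g u).
Proof.
move=> [mf [M fM]] [mg [N gN]]; split; first exact: measurable_funD.
by exists (M + N) => u; apply: le_trans (ler_normD _ _) _; rewrite lerD.
Qed.

Lemma bounded_measurableM f g :
  bounded_measurable f -> bounded_measurable g ->
  bounded_measurable (fun u => f u * g u).
Proof.
move=> [mf [M fM]] [mg [N gN]]; split; first exact: measurable_funM.
by exists (M * N) => u; rewrite normrM ler_pM.
Qed.

Lemma bounded_measurable_sum (I : Type) (r : seq I) (F : I -> U -> R) :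
  (forall i, bounded_measurable (F i)) ->
  bounded_measurable (fun u => \sum_(i <- r) F i u).
Proof.
move=> bF; elim: r => [|i r IHr].
  under eq_fun do rewrite big_nil; exact: bounded_measurable_cst.
by under eq_fun do rewrite big_cons; exact: bounded_measurableD.
Qed.

Lemma bounded_measurable_prod (I : Type) (r : seq I) (p : pred I) (F : I -> U -> R) :
  (forall i, bounded_measurable (F i)) ->
  bounded_measurable (fun u => \prod_(i <- r | p i) F i u).
Proof.
move=> bF; elim: r => [|i r IHr].
  under eq_fun do rewrite big_nil; exact: bounded_measurable_cst.
under eq_fun do rewrite big_cons.
by case: (p i) => //; exact: bounded_measurableM.
Qed.

Lemma bounded_measurable_indic (E : set U) :
  measurable E -> bounded_measurable (\1_E : U -> R).
Proof.
move=> mE; split; first exact: measurable_indic.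
by exists 1 => u; rewrite indicE normr_nat; case: (_ \in _); rewrite ?ler01.
Qed.

(* Replacing h by 2 h - 1_{h >= 1/2} halves Phi h and keeps h in [0, 1]. *)
Lemma bounded_measurable_ind (Phi : (U -> R) -> R) (K : R) :
  (forall f g, bounded_measurable f -> bounded_measurable g ->
     Phi (fun u => f u + g u) = Phi f + Phi g) ->
  (forall c f, bounded_measurable f -> Phi (fun u => c * f u) = c * Phi f) ->
  (forall f, bounded_measurable f -> (forall u, `|f u| <= 1) -> `|Phi f| <= K) ->
  (forall E, measurable E -> Phi \1_E = 0) ->
  forall f, bounded_measurable f -> Phi f = 0.
Proof.
move=> PhiD PhiZ Phi_le Phi1.
(* Because [Phi] vanishes on indicators, the new function has exactly twice the value of [Phi],
   while the bound [K] still applies to it. After [k] rounds, [2 ^+ k] times the original value is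
   below [K]. *)
have halve k h : bounded_measurable h -> (forall u, 0 <= h u <= 1) ->
    `|Phi h| * 2 ^+ k <= K.
  elim: k h => [|k IHk] h bh h01.
    by rewrite mulr1; apply: Phi_le => // u; have /andP[? ?] := h01 u; rewrite ger0_norm.
  pose E := h @^-1` `[2^-1, +oo[.
  have mE : measurable E by rewrite -[E]setTI; apply: bh.1 => //; exact: measurable_itv.
  have b1 := bounded_measurable_indic mE.
  have bN1 := bounded_measurableM (bounded_measurable_cst (-1)) b1.
  have b2 := bounded_measurableM (bounded_measurable_cst 2) bh.
  have /IHk : bounded_measurable (fun u => 2 * h u + -1 * \1_E u).
    exact: bounded_measurableD.
  rewrite PhiD // !PhiZ // Phi1 // mulr0 addr0 normrM gtr0_norm //.
  rewrite -mulrA mulrCA -exprS; apply=> u; have /andP[h0 h1] := h01 u.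
  rewrite indicE; have [uE|uE] := boolP (u \in E).
    move: uE; rewrite mulr1 inE /E /= in_itv /= andbT => hu.
    by apply/andP; split; lra.
  have hu : h u < 2^-1.
    by rewrite ltNge; apply: contra uE => hu; rewrite inE /E /= in_itv /= andbT.
  by rewrite mulr0 addr0; apply/andP; split; lra.
have Phi01 h : bounded_measurable h -> (forall u, 0 <= h u <= 1) -> Phi h = 0.
  move=> bh h01; apply/eqP; rewrite -normr_eq0; apply: contraT => Phi_neq0.
  have Phi_gt0 : 0 < `|Phi h| by rewrite lt_def Phi_neq0 normr_ge0.
  pose k := Num.bound (K / `|Phi h|).
  have K_ge0 : 0 <= K by have := halve 0%N h bh h01; rewrite mulr1; apply: le_trans.
  have k_gt : K / `|Phi h| < k%:R by apply: archi_boundP; rewrite divr_ge0.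
  have k_lt : k%:R < 2 ^+ k :> R by rewrite -natrX ltr_nat ltn_expl.
  have := halve k h bh h01; rewrite mulrC -ler_pdivlMr // => k_le.
  by have := le_lt_trans k_le (lt_trans k_gt k_lt); rewrite ltxx.
(* A general [f] is rescaled affinely into [0, 1]; the [+ 1] keeps the divisor [2 * M] nonzero. The
   constant left over is a multiple of the indicator of the whole space, so [Phi] vanishes on it
   too. *)
move=> f bf; have [_ [M0 fM0]] := bf; pose M := `|M0| + 1.
have M_gt0 : 0 < M by rewrite ltr_wpDl.
have fM u : `|f u| <= M.
  by rewrite (le_trans (fM0 u)) // (le_trans (ler_norm _)) // lerDl.
pose h u := (2 * M)^-1 * (f u + M).
have bh : bounded_measurable h.
  apply: bounded_measurableM (bounded_measurable_cst _) _.
  exact: bounded_measurableD bf (bounded_measurable_cst _).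
have h01 u : 0 <= h u <= 1.
  have := fM u; rewrite ler_norml => /andP[? ?].
  by rewrite /h mulrC divr_ge0 ?ler_pdivrMr ?mulr_gt0 //=; lra.
have -> : f = (fun u => (2 * M) * h u + (- M) * \1_setT u).
  apply/funext => u; rewrite /h indicT mulr1 mulrA mulfV ?mul1r ?addrK //.
  by rewrite gt_eqF // mulr_gt0.
have bT : bounded_measurable (\1_setT : U -> R) by exact: bounded_measurable_indic.
rewrite PhiD; [|exact: bounded_measurableM (bounded_measurable_cst _) _..].
by rewrite (PhiZ _ _ bh) (PhiZ _ _ bT) Phi01 // Phi1 // !mulr0 addr0.
Qed.

End BoundedMeasurable.

Section Expectation.
Context {d : measure_display} {T : measurableType d} {R : realType}.
Variable P : probability T R.
Implicit Types f g : T -> R.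

Lemma bounded_measurable_integrable f :
  bounded_measurable f -> P.-integrable setT (EFin \o f).
Proof.
move=> [mf [M fM]]; apply: measurable_bounded_integrable => //.
  by rewrite /= probability_setT ltry.
exists M; split; first exact: num_real.
by move=> N MN u _; exact: le_trans (fM u) (ltW MN).
Qed.

Let intg := bounded_measurable_integrable.

Lemma Rintegral_bmD f g : bounded_measurable f -> bounded_measurable g ->
  \int[P]_w (f w + g w) = \int[P]_w f w + \int[P]_w g w.
Proof. by move=> bf bg; rewrite RintegralD //; exact: intg. Qed.

Lemma Rintegral_bmZ c f : bounded_measurable f ->
  \int[P]_w (c * f w) = c * \int[P]_w f w.
Proof. by move=> bf; rewrite RintegralZl //; exact: intg. Qed.

Lemma Rintegral_probability_cst c : \int[P]_w c = c.
Proof. by rewrite Rintegral_cst // /= probability_setT mulr1. Qed.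

Lemma Rintegral_bm_sum (I : Type) (r : seq I) (F : I -> T -> R) :
  (forall i, bounded_measurable (F i)) ->
  \int[P]_w (\sum_(i <- r) F i w) = \sum_(i <- r) \int[P]_w F i w.
Proof.
move=> bF; elim: r => [|i r IHr].
  under eq_Rintegral do rewrite big_nil.
  by rewrite Rintegral_probability_cst big_nil.
under eq_Rintegral do rewrite big_cons.
by rewrite Rintegral_bmD ?IHr ?big_cons //; exact: bounded_measurable_sum.
Qed.

Lemma Rintegral_le f g : bounded_measurable f -> bounded_measurable g ->
  (forall w, f w <= g w) -> \int[P]_w f w <= \int[P]_w g w.
Proof. by move=> bf bg fg; apply: le_Rintegral => //; exact: intg. Qed.

Lemma normr_Rintegral_le f M : bounded_measurable f ->
  (forall w, `|f w| <= M) -> `|\int[P]_w f w| <= M.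
Proof.
move=> bf fM; rewrite ler_norml; apply/andP; split.
  rewrite -[leLHS]Rintegral_probability_cst; apply: Rintegral_le => // [|w].
    exact: bounded_measurable_cst.
  by have := fM w; rewrite ler_norml => /andP[].
rewrite -[leRHS]Rintegral_probability_cst; apply: Rintegral_le => // [|w].
  exact: bounded_measurable_cst.
by have := fM w; rewrite ler_norml => /andP[].
Qed.

Lemma Rintegral_indic (E : set T) : measurable E -> \int[P]_w \1_E w = fine (P E).
Proof. by move=> mE; rewrite /Rintegral integral_indic // setIT. Qed.

End Expectation.

Section Independence.
Context {d d' : measure_display} {T : measurableType d} {U : measurableType d'}.
Context {R : realType} (P : probability T R).

Lemma bounded_measurable_RV (X : {RV P >-> U}) (f : U -> R) :
  bounded_measurable f -> bounded_measurable (f \o X).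
Proof.
move=> [mf [M fM]]; split; first exact: measurableT_comp.
by exists M => w; exact: fM.
Qed.

(** The difference of the two means is a linear functional of [f], at most 2 on the unit ball, and
    zero on indicators by hypothesis. *)
Lemma same_distribution_Rintegral (X Y : {RV P >-> U}) (f : U -> R) :
  same_distribution X Y -> bounded_measurable f ->
  \int[P]_w f (X w) = \int[P]_w f (Y w).
Proof.
move=> XY bf; apply/eqP; rewrite -subr_eq0; apply/eqP.
pose Phi (h : U -> R) := \int[P]_w h (X w) - \int[P]_w h (Y w).
apply: (@bounded_measurable_ind _ _ _ Phi 2) bf => [f1 f2 b1 b2|c h bh|h bh h1|E mE].
- rewrite /Phi !Rintegral_bmD; try exact: bounded_measurable_RV.
  by rewrite opprD addrACA.
- by rewrite /Phi !Rintegral_bmZ ?mulrBr //; exact: bounded_measurable_RV.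
- apply: le_trans (ler_normB _ _) _.
  rewrite (_ : 2 = 1 + 1) // lerD // normr_Rintegral_le //;
    exact: bounded_measurable_RV.
- have dE (Z : {RV P >-> U}) : \int[P]_w \1_E (Z w) = fine (distribution P Z E).
    apply: (Rintegral_indic P (E := Z @^-1` E)).
    by rewrite -[_ @^-1` _]setTI; exact: measurable_funP.
  by rewrite /Phi !dE XY // subrr.
Qed.

Variable X : nat -> {RV P >-> U}.
Hypothesis X_indep : mutually_independent X.

(** For indicators this is the definition of independence. The slots are then freed one at a time:
    with all other factors fixed, the difference of the two sides is a bounded linear functional of
    the remaining one. *)
Lemma indep_Rintegral_prod k (f : nat -> U -> R) :
  (forall j, bounded_measurable (f j)) ->
  \int[P]_w (\prod_(j < k) f j (X j w)) = \prod_(j < k) \int[P]_w f j (X j w).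
Proof.
have preE E j : measurable E -> measurable (X j @^-1` E).
  by move=> mE; rewrite -[_ @^-1` _]setTI; exact: measurable_funP.
(* Slots below [l] hold arbitrary bounded functions, slots from [l] on hold indicators; [l = k] is
   the claim. *)
suff slots l : forall f, (forall j, bounded_measurable (f j)) ->
    (forall j, (l <= j < k)%N -> exists2 E, measurable E & f j = \1_E) ->
    \int[P]_w (\prod_(j < k) f j (X j w)) = \prod_(j < k) \int[P]_w f j (X j w).
  by move=> bf; apply: (slots k) => // j; case: ltngtP.
elim: l => [|l IHl] {}f bf f_ind.
  have [E mE fE] : exists2 E : nat -> set U, forall j, measurable (E j) &
      forall j, (j < k)%N -> f j = \1_(E j).
    have /choice[E EP] : forall j, exists E, measurable E /\ ((j < k)%N -> f j = \1_E).
      (* Independence asks for a measurable event at every index, so indices beyond [k] receive the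
         whole space. *)
      move=> j; have [jk|kj] := ltnP j k; last by exists setT.
      by have [E] := f_ind j jk; exists E.
    by exists E => j; have [] := EP j.
  have mB : measurable (\bigcap_(j in [set` iota 0 k]) (X j @^-1` E j)).
    by apply: fin_bigcap_measurable => // j _; exact: preE.
  transitivity (\int[P]_w \1_(\bigcap_(j in [set` iota 0 k]) (X j @^-1` E j)) w).
    apply: eq_Rintegral => w _; rewrite indicE.
    have [wB|wB] := boolP (w \in _).
      rewrite big1 // => j _; rewrite fE ?ltn_ord // indicE mem_set //.
      by move: wB; rewrite inE => /(_ (j : nat)); apply; rewrite /= mem_iota /=.
    rewrite (_ : false%:R = 0) //; apply/eqP; apply: contraNT wB => /prodf_neq0 neq0.
    rewrite inE => j /=; rewrite mem_iota add0n => /= jk.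
    have := neq0 (Ordinal jk) isT; rewrite /= fE // indicE.
    by case: (boolP (X j w \in E j)); rewrite ?inE // eqxx.
  rewrite Rintegral_indic // X_indep ?iota_uniq //.
  rewrite -{1}[k]subn0 -/(index_iota 0 k) big_mkord.
  have prodE : (\prod_(j < k) P (X j @^-1` E j) =
      (\prod_(j < k) \int[P]_w f j (X j w))%:E)%E.
    rewrite -prodEFin; apply: eq_bigr => j _; rewrite fE ?ltn_ord //.
    rewrite -[LHS]fineK ?fin_num_measure //; last exact: preE.
    by rewrite -Rintegral_indic //; exact: preE.
  by rewrite prodE.
have [lk|kl] := ltnP l k; last first.
  by apply: IHl => // j /andP[lj jk]; have := leq_trans kl lj; rewrite leqNgt jk.
pose l' := Ordinal lk.
pose G w := \prod_(j < k | j != l') f j (X j w).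
pose c := \prod_(j < k | j != l') \int[P]_w f j (X j w).
have bG : bounded_measurable G.
  by apply: bounded_measurable_prod => j; exact: bounded_measurable_RV (bf j).
have [_ [K GK]] := bG.
pose Phi (h : U -> R) := \int[P]_w (h (X l w) * G w) - \int[P]_w h (X l w) * c.
suff /eqP : Phi (f l) = 0.
  rewrite subr_eq0 => /eqP Phi0; rewrite (bigD1 l') //= -Phi0.
  by apply: eq_Rintegral => w _; rewrite (bigD1 l').
apply: (@bounded_measurable_ind _ _ _ Phi (K + `|c|)) (bf l)
    => [f1 f2 b1 b2|a h bh|h bh h1|E mE]; rewrite /Phi.
- under eq_Rintegral do rewrite mulrDl.
  rewrite !Rintegral_bmD; try exact: bounded_measurable_RV;
    try exact: bounded_measurableM (bounded_measurable_RV _ _) bG.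
  by rewrite mulrDl opprD addrACA.
- under eq_Rintegral do rewrite -mulrA.
  rewrite !Rintegral_bmZ; try exact: bounded_measurable_RV;
    try exact: bounded_measurableM (bounded_measurable_RV _ _) bG.
  by rewrite mulrBr mulrA.
- apply: le_trans (ler_normB _ _) _; apply: lerD.
    apply: normr_Rintegral_le => [|w].
      exact: bounded_measurableM (bounded_measurable_RV _ _) bG.
    by rewrite normrM -[K]mul1r ler_pM.
  rewrite normrM ler_piMl // normr_Rintegral_le //.
  exact: bounded_measurable_RV.
(* With an indicator put back in slot [l], the family falls under the induction hypothesis. *)
- pose g j := if j == l then \1_E else f j.
  have gl : g l = \1_E by rewrite /g eqxx.
  have gE (j : 'I_k) : j != l' -> g j = f j.
    by move=> jl; rewrite /g ifN.
  have := IHl g; rewrite (bigD1 l') //= (eq_bigr (fun j : 'I_k => \int[P]_w f j (X j w))).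
    rewrite -/c gl => <-; first last.
    - move=> j /andP[lj jk]; rewrite /g; case: eqP => [_|/eqP jl]; first by exists E.
      by apply: f_ind; rewrite ltn_neqAle eq_sym jl lj.
    - by move=> j; rewrite /g; case: ifP => // _; exact: bounded_measurable_indic.
    apply/eqP; rewrite subr_eq0; apply/eqP; apply: eq_Rintegral => w _.
    rewrite [RHS](bigD1 l') //= gl; congr (_ * _).
    by apply: eq_bigr => j /gE ->.
  by move=> j /gE ->.
Qed.

End Independence.

(** * Measurability of the sketched projection *)

(** Inversion is continuous on the open set of nonzero reals; the remaining point is a measurable
    singleton. *)
Lemma measurable_invr (R : realType) : measurable_fun setT (@GRing.inv R).
Proof.
rewrite -(setUv [set (0 : R)]); apply/measurable_funU => //.
  exact: measurableC.
split; first exact: measurable_fun_set1.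
apply: open_continuous_measurable_fun.
  by rewrite openC; exact: closed_eq.
by move=> x; rewrite inE /= => /eqP x_neq0; exact: inv_continuous.
Qed.

Section MeasurableMatrix.
Context {d : measure_display} {T : measurableType d} {R : realType}.

Definition measurable_mx p q (F : T -> 'M[R]_(p, q)) :=
  forall i j, measurable_fun setT (fun t => F t i j).

Lemma measurable_mx_cst p q (M : 'M[R]_(p, q)) : measurable_mx (fun=> M).
Proof. by move=> i j; exact: measurable_cst. Qed.

Lemma measurable_mxD p q (F G : T -> 'M[R]_(p, q)) :
  measurable_mx F -> measurable_mx G -> measurable_mx (fun t => F t + G t).
Proof.
by move=> mF mG i j; under eq_fun do rewrite mxE; exact: measurable_funD.
Qed.

Lemma measurable_mxM p q r (F : T -> 'M[R]_(p, q)) (G : T -> 'M[R]_(q, r)) :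
  measurable_mx F -> measurable_mx G -> measurable_mx (fun t => F t *m G t).
Proof.
move=> mF mG i j; under eq_fun do rewrite mxE.
by apply: measurable_sum => k; exact: measurable_funM.
Qed.

Lemma measurable_det p (F : T -> 'M[R]_p) :
  measurable_mx F -> measurable_fun setT (fun t => \det (F t)).
Proof.
move=> mF; rewrite /determinant; apply: measurable_sum => s.
apply: measurable_funM; first exact: measurable_cst.
by apply: measurable_prod => i _; exact: mF.
Qed.

(** Cramer's formula: each entry is a cofactor divided by the determinant. *)
Lemma measurable_invmx p (F : T -> 'M[R]_p) :
  measurable_mx F -> (forall t, F t \in unitmx) ->
  measurable_mx (fun t => invmx (F t)).
Proof.
move=> mF F_unit i j.
have -> : (fun t => invmx (F t) i j) =
    (fun t => (\det (F t))^-1 * ((-1) ^+ (j + i) * \det (row' j (col' i (F t))))).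
  by apply/funext => t; rewrite /invmx F_unit !mxE.
apply: measurable_funM.
  by apply: measurableT_comp; [exact: measurable_invr | exact: measurable_det].
apply: measurable_funM; first exact: measurable_cst.
apply: measurable_det => k l; under eq_fun do rewrite !mxE; exact: mF.
Qed.

End MeasurableMatrix.

Section Sketch.
Context {R : realType} {m n : nat}.

(** The sigma-algebra on sketches is tested separately for each number of columns, and there the
    preimage of an open interval is open. *)
Lemma measurable_fun_sketch (f : sketch R m -> R) :
  (forall q, continuous (fun M : 'M[R]_(m, q) => f (existT _ q M))) ->
  measurable_fun setT f.
Proof.
move=> cf; apply: (measurability _ (RGenOpens.measurableE R)).
move=> _ [_ [a [b ->] <-]]; rewrite setTI.
rewrite -[measurable _]/(sketch_measurable (f @^-1` `]a, b[)) => q.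
apply: sub_sigma_algebra.
have /continuousP := cf q; apply; exact: interval_open.
Qed.

(** [S S^T] is [m] by [m] for any number of columns, so from here on the matrices have a fixed
    size. *)
Lemma measurable_sketch_gram :
  measurable_mx (fun s : sketch R m => tagged s *m (tagged s)^T).
Proof.
move=> i j; apply: measurable_fun_sketch => q /=.
have -> : (fun M : 'M[R]_(m, q) => (M *m M^T) i j) =
    (fun M => \sum_k M i k * M j k).
  by apply/funext => M; rewrite mxE; apply: eq_bigr => k _; rewrite mxE.
apply: continuous_big => [|k _]; first exact: add_continuous.
by move=> M; apply: continuousM; exact: coord_continuous.
Qed.

Lemma measurable_range_proj (K : 'M[R]_(n, m)) :
  measurable_mx (fun s : sketch R m => range_proj (K *m tagged s)).
Proof.
move=> i j; pose G (s : sketch R m) := K *m (tagged s *m (tagged s)^T) *m K^T.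
have mG : measurable_mx G.
  apply: measurable_mxM; last exact: measurable_mx_cst.
  by apply: measurable_mxM; [exact: measurable_mx_cst | exact: measurable_sketch_gram].
pose e k : R := k.+1%:R^-1.
pose h k s := (G s *m invmx (G s + (e k)%:M)) i j.
have GE s : G s = (K *m tagged s) *m (K *m tagged s)^T.
  by rewrite /G trmx_mul !mulmxA.
(* The regularization parameter runs through [1 / (k + 1)]. The rate constant depends on [s], so the
   limit is only pointwise, which is enough for measurability. *)
apply: (@measurable_fun_cvg _ _ _ _ h) => [k|s _].
  apply: measurable_mxM => //; apply: measurable_invmx => [|s].
    by apply: measurable_mxD => //; exact: measurable_mx_cst.
  by rewrite GE; apply: resolvent_unitmx; rewrite invr_gt0.
have [c c_le] := range_proj_resolvent (K *m tagged s) i j.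
apply/cvgrPdist_le => eps eps_gt0.
have ce0 : c * e k @[k --> \oo] --> (0 : R).
  by rewrite -(mulr0 c); apply: cvgMl_tmp; exact: cvg_harmonic.
have := ce0; move/cvgrPdist_le => /(_ eps eps_gt0); apply: filterS => k.
rewrite sub0r normrN => ck; apply: le_trans ck; apply: le_trans (ler_norm _).
by rewrite /h GE; apply: c_le; rewrite invr_gt0.
Qed.

Variables (A : 'M[R]_(m, n)) (B : 'M[R]_n).
Hypothesis B_spd : spd B.

Lemma bounded_measurable_range_proj (K : 'M[R]_(n, m)) i j :
  bounded_measurable (fun s : sketch R m => range_proj (K *m tagged s) i j).
Proof.
split; first exact: measurable_range_proj.
by exists 1 => s; apply: proj_entry_le1; [exact: range_proj_sym | exact: range_proj_idem].
Qed.

Lemma bounded_measurable_Zmx i j : bounded_measurable (fun s => Zmx A B s i j).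
Proof.
under eq_fun do rewrite (Zmx_conj A B_spd) mxE.
apply: bounded_measurable_sum => k.
apply: bounded_measurableM (bounded_measurable_cst _).
under eq_fun do rewrite mxE.
apply: bounded_measurable_sum => l.
apply: bounded_measurableM (bounded_measurable_cst _) _.
exact: bounded_measurable_range_proj.
Qed.

End Sketch.

(** * Expected error *)

Section MatrixExpectation.
Context {d : measure_display} {T : measurableType d} {R : realType}.
Variable P : probability T R.

Definition bounded_measurable_mx p q (F : T -> 'M[R]_(p, q)) :=
  forall i j, bounded_measurable (fun w => F w i j).

Lemma mexpectationE p q (F : T -> 'M[R]_(p, q)) i j :
  mexpectation P F i j = \int[P]_w F w i j.
Proof. by rewrite mxE unlock. Qed.

Lemma mexpectation_cst p q (M : 'M[R]_(p, q)) : mexpectation P (fun=> M) = M.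
Proof.
by apply/matrixP => i j; rewrite mexpectationE Rintegral_probability_cst.
Qed.

Lemma mexpectation_mulmxl p q r (L : 'M[R]_(p, q)) (F : T -> 'M[R]_(q, r)) :
  bounded_measurable_mx F ->
  mexpectation P (fun w => L *m F w) = L *m mexpectation P F.
Proof.
move=> bF; apply/matrixP => i j; rewrite mexpectationE mxE.
under eq_Rintegral do rewrite mxE.
rewrite Rintegral_bm_sum => [|k].
  by apply: eq_bigr => k _; rewrite mexpectationE Rintegral_bmZ.
exact: bounded_measurableM (bounded_measurable_cst _) (bF k j).
Qed.

Lemma mexpectation_tr p q (F : T -> 'M[R]_(p, q)) :
  mexpectation P (fun w => (F w)^T) = (mexpectation P F)^T.
Proof.
apply/matrixP => i j; rewrite [RHS]mxE !mexpectationE.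
by apply: eq_Rintegral => w _; rewrite mxE.
Qed.

Lemma mexpectation_mulmxr p q r (F : T -> 'M[R]_(p, q)) (L : 'M[R]_(q, r)) :
  bounded_measurable_mx F ->
  mexpectation P (fun w => F w *m L) = mexpectation P F *m L.
Proof.
move=> bF; apply: trmx_inj; rewrite trmx_mul -!mexpectation_tr.
under eq_fun do rewrite trmx_mul.
by rewrite mexpectation_mulmxl // => i j; under eq_fun do rewrite mxE.
Qed.

Lemma mexpectation_subl p q (M : 'M[R]_(p, q)) (F : T -> 'M[R]_(p, q)) :
  bounded_measurable_mx F ->
  mexpectation P (fun w => M - F w) = M - mexpectation P F.
Proof.
move=> bF; apply/matrixP => i j; rewrite coord_mxB !mexpectationE.
under eq_Rintegral do rewrite coord_mxB -mulN1r.
rewrite Rintegral_bmD ?Rintegral_bmZ ?Rintegral_probability_cst ?mulN1r //.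
  exact: bounded_measurable_cst.
exact: bounded_measurableM (bounded_measurable_cst _) (bF i j).
Qed.

Lemma bounded_measurable_mulmxl p q r (L : 'M[R]_(p, q)) (F : T -> 'M[R]_(q, r)) :
  bounded_measurable_mx F -> bounded_measurable_mx (fun w => L *m F w).
Proof.
move=> bF i j; under eq_fun do rewrite mxE; apply: bounded_measurable_sum => k.
exact: bounded_measurableM (bounded_measurable_cst _) (bF k j).
Qed.

(** For each fixed [x] both bounds are linear in the matrix, so they can be integrated. *)
Lemma mexpectation_contraction n (F : T -> 'M[R]_n) :
  bounded_measurable_mx F -> (forall w, symmetric_contraction (F w)) ->
  symmetric_contraction (mexpectation P F).
Proof.
move=> bF F_contr; split.
  rewrite -mexpectation_tr; congr mexpectation; apply/funext => w.
  by have [] := F_contr w.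
move=> x; have bxF := bounded_measurable_mulmxl x^T bF.
have bxFx : bounded_measurable (fun w => (x^T *m F w *m x) 0 0).
  under eq_fun do rewrite mxE; apply: bounded_measurable_sum => k.
  exact: bounded_measurableM (bxF 0 k) (bounded_measurable_cst _).
rewrite -mexpectation_mulmxl // -mexpectation_mulmxr // mexpectationE.
rewrite -[X in X <= _ <= _](Rintegral_probability_cst P).
rewrite -[X in _ <= _ <= X](Rintegral_probability_cst P).
by apply/andP; split; apply: Rintegral_le => //; do ?exact: bounded_measurable_cst;
  move=> w; have [_ /(_ x)/andP[]] := F_contr w.
Qed.

End MatrixExpectation.

(** * Random variables determined by the past draws *)

Section PastMeasurable.
Context {d d' : measure_display} {T : measurableType d} {U : measurableType d'}.
Context {R : realType} (P : probability T R) (X : nat -> {RV P >-> U}).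

(* [g] behaves as a function of X 0, ..., X (k - 1): it is uncorrelated with
   products of functions of the later variables. *)
Definition past_measurable k (g : T -> R) :=
  bounded_measurable g /\ forall N (f : nat -> U -> R),
    (forall j, bounded_measurable (f j)) ->
    \int[P]_w (g w * \prod_(j < N) f j (X (k + j)%N w)) =
    \int[P]_w g w * \prod_(j < N) \int[P]_w f j (X (k + j)%N w).

(** The start of the induction and the point where independence enters: before any draw, the
    required formula is the product formula for the whole family. *)
Lemma past_measurable_cst c :
  mutually_independent X -> past_measurable 0 (fun=> c).
Proof.
move=> X_indep; split=> [|N f bf]; first exact: bounded_measurable_cst.
rewrite Rintegral_probability_cst Rintegral_bmZ.
  by rewrite (indep_Rintegral_prod X_indep).
by apply: bounded_measurable_prod => j; exact: bounded_measurable_RV (bf j).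
Qed.

Lemma past_measurable_uncorrelated k g h :
  past_measurable k g -> bounded_measurable h ->
  \int[P]_w (h (X k w) * g w) = \int[P]_w h (X k w) * \int[P]_w g w.
Proof.
move=> [bg g_past] bh; have := g_past 1%N (fun=> h) (fun=> bh).
rewrite big_ord1 addn0 mulrC => <-.
by apply: eq_Rintegral => w _; rewrite big_ord1 addn0 mulrC.
Qed.

(** The new factor [h (X k)] is put in front of the later ones, so the formula for [g] with [N + 1]
    factors yields the one for the product with [N]. *)
Lemma past_measurableM k g h :
  past_measurable k g -> bounded_measurable h ->
  past_measurable k.+1 (fun w => h (X k w) * g w).
Proof.
move=> g_past bh; have [bg g_prod] := g_past.
split=> [|N f bf]; first exact: bounded_measurableM (bounded_measurable_RV _ bh) bg.
rewrite past_measurable_uncorrelated //.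
pose f' j := if j is j'.+1 then f j' else h.
have bf' j : bounded_measurable (f' j) by case: j.
(* Stated for an arbitrary [G] so as to reindex both the pointwise product and the product of
   integrals. *)
have shift (G : (U -> R) -> {RV P >-> U} -> R) :
    \prod_(j < N.+1) G (f' j) (X (k + j)%N) =
    G h (X k) * \prod_(j < N) G (f j) (X (k.+1 + j)%N).
  rewrite big_ord_recl addn0; congr (_ * _); apply: eq_bigr => j _.
  by rewrite lift0 addSnnS.
have := g_prod N.+1 f' bf'.
rewrite (shift (fun u Y => \int[P]_w u (Y w))) mulrA [_ * \int[P]_w h _]mulrC => <-.
apply: eq_Rintegral => w _.
by rewrite (shift (fun u Y => u (Y w))) mulrA [g w * _]mulrC.
Qed.

Lemma past_measurable_sum k (I : Type) (r : seq I) (F : I -> T -> R) :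
  (forall i, past_measurable k (F i)) ->
  past_measurable k (fun w => \sum_(i <- r) F i w).
Proof.
move=> F_past; have bF i := (F_past i).1.
split=> [|N f bf]; first exact: bounded_measurable_sum.
have bp : bounded_measurable (fun w => \prod_(j < N) f j (X (k + j)%N w)).
  by apply: bounded_measurable_prod => j; exact: bounded_measurable_RV (bf j).
under eq_Rintegral do rewrite mulr_suml.
rewrite !Rintegral_bm_sum //; last by move=> i; exact: bounded_measurableM.
by rewrite mulr_suml; apply: eq_bigr => i _; exact: (F_past i).2.
Qed.

End PastMeasurable.

Theorem theorem15 (R : realType) (d : measure_display) (T : measurableType d)
    (P : probability T R) (m n : nat) (n_gt0 : (0 < n)%N)
    (A : 'M[R]_(m, n)) (b : 'cV[R]_m) (B : 'M[R]_n)
    (consistent : exists x : 'cV[R]_n, A *m x = b) (B_spd : spd B)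
    (S : {RV P >-> sketch R m}) (Sk : nat -> {RV P >-> sketch R m})
    (Sk_copy : forall k, same_distribution (Sk k) S)
    (Sk_indep : mutually_independent Sk)
    (x0 : 'cV[R]_n) (x : nat -> T -> 'cV[R]_n)
    (x_0 : forall w, x 0%N w = x0)
    (x_S : forall k w, x k.+1 w = sketch_step A b B (Sk k w) (x k w)) :
  [/\ forall (xs : 'cV[R]_n) (k : nat), A *m xs = b ->
        mexpectation P (fun w => x k.+1 w - xs) =
        (1%:M - invmx B *m mexpectation P (fun w => Zmx A B (S w)))
          *m mexpectation P (fun w => x k w - xs),
      opnorm B (1%:M - invmx B *m mexpectation P (fun w => Zmx A B (S w))) =
        1 - lambda_min (sqrtmx (invmx B)
                          *m mexpectation P (fun w => Zmx A B (S w))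
                          *m sqrtmx (invmx B)),
      1 - lambda_min (sqrtmx (invmx B)
                        *m mexpectation P (fun w => Zmx A B (S w))
                        *m sqrtmx (invmx B)) = rho P A B S &
      forall (xs : 'cV[R]_n) (k : nat), A *m xs = b ->
        vnorm B (mexpectation P (fun w => x k w - xs)) <=
        rho P A B S ^+ k * vnorm B (x0 - xs)].
Proof.
pose Z w := Zmx A B (S w); pose C := sqrtmx (invmx B).
have bZ : bounded_measurable_mx Z.
  by move=> i j; exact: bounded_measurable_RV (bounded_measurable_Zmx A B_spd i j).
pose D s := 1%:M - invmx B *m Zmx A B s.
have bD i j : bounded_measurable (fun s => D s i j).
  under eq_fun do rewrite coord_mxB -mulN1r.
  apply: bounded_measurableD (bounded_measurable_cst _) _.
  apply: bounded_measurableM (bounded_measurable_cst _) _.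
  by apply: bounded_measurable_mulmxl => k l; exact: bounded_measurable_Zmx.
have ED : mexpectation P (D \o S) = 1%:M - invmx B *m mexpectation P Z.
  rewrite -mexpectation_mulmxl // -mexpectation_subl //.
  exact: bounded_measurable_mulmxl.
have x_err xs k w : A *m xs = b -> x k.+1 w - xs = D (Sk k w) *m (x k w - xs).
  by move=> Axs; rewrite x_S (sketch_step_error _ _ _ Axs).
(* The error at time [k] involves the draws before [k] only; each step multiplies its coordinates by
   entries of [D (Sk k)] and sums. *)
have x_past xs k i : A *m xs = b ->
    past_measurable Sk k (fun w => (x k w - xs) i 0).
  move=> Axs; elim: k i => [|k IHk] i.
    by under eq_fun do rewrite x_0; exact: past_measurable_cst.
  under eq_fun do rewrite x_err // mxE.
  by apply: past_measurable_sum => j; exact: past_measurableM (IHk j) (bD i j).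
have mean_step xs k : A *m xs = b -> mexpectation P (fun w => x k.+1 w - xs) =
    (1%:M - invmx B *m mexpectation P Z) *m mexpectation P (fun w => x k w - xs).
  move=> Axs; rewrite -ED; apply/colP => i; rewrite mexpectationE [RHS]mxE.
  under eq_Rintegral do rewrite x_err // mxE.
  have bDx j : bounded_measurable (fun w => D (Sk k w) i j * (x k w - xs) j 0).
    exact: bounded_measurableM (bounded_measurable_RV _ (bD i j)) (x_past xs k j Axs).1.
  rewrite Rintegral_bm_sum //; apply: eq_bigr => j _; rewrite !mexpectationE.
  (* The mean of the product splits because the error is built from earlier draws; equality in law
     then replaces [Sk k] by [S]. *)
  rewrite (past_measurable_uncorrelated (x_past xs k j Axs) (bD i j)).
  by rewrite (same_distribution_Rintegral (Sk_copy k) (bD i j)).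
have H_contr : symmetric_contraction (C *m mexpectation P Z *m C).
  have bCZ := bounded_measurable_mulmxl C bZ.
  rewrite -mexpectation_mulmxl // -mexpectation_mulmxr //.
  have -> : (fun w => C *m Z w *m C) =
      (fun w => range_proj (C *m A^T *m tagged (S w))).
    by apply/funext => w; rewrite /Z Zmx_range_proj.
  apply: mexpectation_contraction => [i j|w].
    exact: (bounded_measurable_RV S (bounded_measurable_range_proj (C *m A^T) i j)).
  have [Ps Pi] := (range_proj_sym (C *m A^T *m tagged (S w)),
                   range_proj_idem (C *m A^T *m tagged (S w))).
  by split=> // y; rewrite proj_ge0 // proj_le.
split=> //; first exact: opnorm_contraction.
move=> xs k Axs; elim: k => [|k IHk].
  rewrite mul1r; under eq_fun do rewrite x_0.
  by rewrite mexpectation_cst.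
rewrite mean_step //; apply: le_trans (vnorm_contraction B_spd H_contr n_gt0 _) _.
(* The induction hypothesis is multiplied by [rho], which needs [rho >= 0], that is
   [lambda_min <= 1]. *)
have [lambda_le1 _ _] := lambda_min_contraction n_gt0 H_contr.
by rewrite exprS -mulrA ler_wpM2l // subr_ge0.
Qed.
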